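(* Let $H$ be a hypergraph. For each unit $W_E$ in $H$ with $|W_E|>1$, the adjacency matrix $A_{(1,H)}$ has an eigenvalue $-\langle s_u,s_v\rangle$ of multiplicity $|W_E|-1$, where $u,v\in W_E$ with $v\neq u$.
   Context: A hypergraph $H$ is a pair $(V(H),E(H))$ with $V(H)$ a non-empty set (vertices) and $E(H)$ a set of non-empty subsets of $V(H)$ (hyperedges). The edge-vertex incidence matrix $B_H=[b_{ev}]_{e\in E(H),v\in V(H)}$ has $b_{ev}=1$ if $v\in e$ and $b_{ev}=0$ otherwise. For $v\in V(H)$, $s_v:E(H)\to\mathbb{C}$ denotes the column of $B_H$ indexed by $v$. The inner product is $\langle x,y\rangle=\sum_{e\in E(H)}x(e)\overline{y(e)}$ for $x,y:E(H)\to\mathbb{C}$. The star of a vertex $v$ is $E_v(H)=\{e\in E(H): v\in e\}$. A unit in $H$ is an equivalence class of the equivalence relation $\{(u,v)\in V(H)\times V(H): E_u(H)=E_v(H)\}$; $W_E$ denotes the unit all of whose vertices have star $E\subseteq E(H)$. $A_{(1,H)}=[a_{uv}]_{u,v\in V(H)}$ is the matrix with $a_{uv}=|E_u(H)\cap E_v(H)|$ for distinct $u,v$ and zero diagonal entries.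
   Formalization: ''Of multiplicity |W_E|-1'' is read as ''of multiplicity at least |W_E|-1'' (geometric and algebraic), since equality fails, e.g. for two disjoint edges {1,2},{3,4}, where -1 has multiplicity 2; the hypergraph is taken finite. *)

(* Defs.v *)
From mathcomp Require Import all_boot all_order all_algebra.

Set Implicit Arguments.
Unset Strict Implicit.
Unset Printing Implicit Defensive.

Import Order.TTheory GRing.Theory Num.Theory.
Local Open Scope ring_scope.

(* Hypergraphs are finite, as their incidence and adjacency matrices and the
   sum over E(H) in the inner product require. *)
Record hypergraph : Type := Hypergraph {
  vertex : finType;
  hyperedges : {set {set vertex}};
  vertex_gt0 : (0 < #|vertex|)%N;
  set0_notin_hyperedges : set0 \notin hyperedges
}.

Section Hypergraph.
Variable H : hypergraph.
Implicit Types u v : vertex H.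

Definition star v : {set {set vertex H}} := [set e in hyperedges H | v \in e].

Definition same_star : rel (vertex H) := [rel u v | star u == star v].

(* The unit W_E is the block W of this partition whose vertices have star E. *)
Definition units : {set {set vertex H}} :=
  equivalence_partition same_star [set: vertex H].

End Hypergraph.

Section Matrices.
Variables (C : numClosedFieldType) (H : hypergraph).

(* Rows and columns are indexed by the hyperedges and vertices through their
   enumerations: row i is the hyperedge enum_val i, the column of v is enum_rank v. *)
Definition incidence_mx : 'M[C]_(#|hyperedges H|, #|vertex H|) :=
  \matrix_(i < #|hyperedges H|, j < #|vertex H|)
    (enum_val j \in (enum_val i : {set vertex H}))%:R.

Definition incidence_col (v : vertex H) : 'cV[C]_#|hyperedges H| :=
  col (enum_rank v) incidence_mx.

Definition edge_inner (x y : 'cV[C]_#|hyperedges H|) : C :=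
  \sum_i x i 0 * (y i 0)^*.

Definition adjacency1_mx : 'M[C]_#|vertex H| :=
  \matrix_(i < #|vertex H|, j < #|vertex H|)
    (if i == j then 0 else #|star (enum_val i) :&: star (enum_val j)|%:R).

End Matrices.

Arguments incidence_col C {H} v.

(* Main.v *)
Require Import Defs.
From mathcomp Require Import all_boot all_order all_algebra.
From mathcomp Require Import reals.
From mathcomp.real_closed Require Import complex.
Import Order.TTheory GRing.Theory Num.Theory.
Local Open Scope ring_scope.
Local Open Scope complex_scope.

(** If u and w have the same star E, then every third vertex is adjacent to u
    and to w with the same weight, so the rows of u and w in the adjacency
    matrix A differ only in the columns u and w, where the difference is |E|
    and -|E|. Hence the vector e_w - e_u is a left eigenvector of A for the
    eigenvalue -|E|, and |E| is the inner product of any two incidence columns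
    from the unit of u ([edge_innerE]). Fixing u in the unit W and letting w
    range over W minus u gives |W| - 1 such vectors ([vertex_diff_mul_adjacency]);
    each of them is the only one with a nonzero coordinate at its w, so they are
    independent ([vertex_diff_mx_free]). This bounds the geometric multiplicity
    from below. The algebraic multiplicity is always at least the geometric one:
    in a basis extending one of the eigenspace, the factor 'X - a comes out of
    as many rows of the characteristic matrix as the dimension of the eigenspace
    ([exp_rank_eigenspace_dvd_char_poly]). *)

(** Rather than passing to a similar block triangular matrix, multiply the
    characteristic matrix on the left by an invertible constant matrix P whose
    first r rows span the eigenspace: these rows become 'X - a times rows of P,
    so 'X - a comes out of the determinant r times, while det P is a nonzero
    constant. *)
Lemma exp_rank_eigenspace_dvd_char_poly (F : fieldType) (n : nat)
    (A : 'M[F]_n) (a : F) :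
  ('X - a%:P) ^+ \rank (eigenspace A a) %| char_poly A.
Proof.
set E := eigenspace A a; set r := \rank E; set P := row_ebase E.
(* E is col_ebase E, an invertible matrix, times pid_mx r *m P. *)
have Pr_eigen : pid_mx r *m P *m A = a *: (pid_mx r *m P) :> 'M_n.
  apply/eigenspaceP; rewrite -/E -(eqmxMfull _ (_ : row_full (col_ebase E))).
    by rewrite mulmxA mulmx_ebase.
  by rewrite row_full_unit col_ebase_unit.
have rowP_eigen (i : 'I_n) : (i < r)%N -> row i (P *m A) = a *: row i P.
  move=> ltir; have row_pid (B : 'M[F]_n) : row i (pid_mx r *m B) = row i B.
    rewrite row_mul [RHS]rowE; congr (_ *m B); apply/rowP => j.
    by rewrite !mxE ltir andbT eqxx eq_sym.
  by rewrite -row_pid mulmxA Pr_eigen linearZ /= row_pid.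
pose D : 'M[{poly F}]_n :=
  diag_mx (\row_i (if (i < r)%N then 'X - a%:P else 1)).
pose PC := map_mx polyC P.
pose Q : 'M[{poly F}]_n :=
  \matrix_i (if (i < r)%N then row i PC else row i (PC *m char_poly_mx A)).
have factorD : PC *m char_poly_mx A = D *m Q.
  apply/row_matrixP => i; rewrite [RHS]row_mul row_diag_mx mxE -scalemxAl -rowE rowK.
  case: ifP => [ltir | _]; last by rewrite scale1r.
  rewrite /char_poly_mx mulmxBr linearB /= -map_mxM -map_row rowP_eigen //.
  by rewrite mul_mx_scalar linearZ /= map_mxZ scalerBl map_row.
have detD : \det D = ('X - a%:P) ^+ r.
  rewrite det_diag (eq_bigr (fun i : 'I_n => if (i < r)%N then 'X - a%:P else 1)).
    rewrite -big_mkcond /= prodr_const; congr (_ ^+ _).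
    by rewrite -sum1_card (big_ord_narrow (rank_leq_row E)) sum1_card card_ord.
  by move=> i _; rewrite mxE.
have detP_neq0 : \det P != 0 by rewrite -unitfE -unitmxE row_ebase_unit.
rewrite -detD -(dvdpZr _ _ detP_neq0) -mul_polyC -det_map_mx -det_mulmx.
by rewrite factorD det_mulmx dvdp_mulr.
Qed.

Lemma edge_innerE (C : numClosedFieldType) (H : hypergraph) (u v : vertex H) :
  edge_inner (incidence_col C u) (incidence_col C v) = #|star u :&: star v|%:R.
Proof.
pose common (e : {set vertex H}) : C := ((u \in e) && (v \in e))%:R.
transitivity (\sum_(e in hyperedges H) common e).
  rewrite big_enum_val; apply: eq_bigr => i _.
  by rewrite !mxE !enum_rankK conjC_nat -natrM mulnb.
rewrite -sum1_card natr_sum [RHS](eq_bigl (fun e : {set vertex H} =>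
  (e \in hyperedges H) && ((u \in e) && (v \in e)))); last first.
  by move=> e; rewrite /= !inE; case: (_ \in hyperedges H).
by rewrite big_mkcondr; apply: eq_bigr => e _; rewrite /common; case: (_ && _).
Qed.

Section VertexDifferences.
Variables (C : numClosedFieldType) (H : hypergraph).
Implicit Types u w : vertex H.

Definition vertex_diff u w : 'rV[C]_#|vertex H| :=
  delta_mx 0 (enum_rank w) - delta_mx 0 (enum_rank u).

(** In the matrix of all the |E_x :&: E_y|, diagonal included, the rows of u and
    w are equal, so this vector would be in the kernel. Clearing the diagonal
    subtracts |E_u| at the coordinates u and w, which moves the eigenvalue from
    0 to -|E_u|. *)
Lemma vertex_diff_mul_adjacency u w : star w = star u ->
  vertex_diff u w *m adjacency1_mx C H = - #|star u|%:R *: vertex_diff u w.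
Proof.
move=> eq_star; have [-> | neq_wu] := eqVneq w u.
  by rewrite /vertex_diff subrr mul0mx scaler0.
rewrite /vertex_diff mulmxBl -!rowE; apply/rowP => j.
rewrite !mxE !enum_rankK eqxx /= eq_star ![j == _]eq_sym.
case: (eqVneq (enum_rank w)) => [<- | _].
  by rewrite (inj_eq enum_rank_inj) eq_sym (negPf neq_wu) enum_rankK eq_star setIid
     sub0r subr0 mulr1.
case: eqVneq => [<- | _]; last by rewrite !subrr mulr0.
by rewrite enum_rankK setIid subr0 sub0r mulrNN mulr1.
Qed.

Definition vertex_diff_mx u (S : {set vertex H}) : 'M[C]_(#|S|, #|vertex H|) :=
  \matrix_(i < #|S|) vertex_diff u (enum_val i).

Lemma vertex_diff_mx_free u (S : {set vertex H}) :
  u \notin S -> row_free (vertex_diff_mx u S).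
Proof.
move=> uS; apply/row_freeP.
(* Reading off the coordinates in S recovers the coefficients. *)
exists (\matrix_(j, i) (j == enum_rank (enum_val i : vertex H))%:R).
apply/matrixP => i k; rewrite !mxE (bigD1 (enum_rank (enum_val k))) //=.
rewrite big1 => [|j /negPf neq_j]; last by rewrite !mxE neq_j mulr0.
rewrite !mxE !eqxx mulr1 addr0 !(inj_eq enum_rank_inj) (inj_eq enum_val_inj).
have /negPf -> : enum_val k != u by apply: contraNneq uS => <-; apply: enum_valP.
by rewrite subr0 eq_sym.
Qed.

End VertexDifferences.

Lemma unit_same_star (H : hypergraph) (W : {set vertex H}) (u v : vertex H) :
  W \in units H -> u \in W -> v \in W -> star v = star u.
Proof.
by case/imsetP => x _ ->; rewrite !inE => /eqP <- /eqP <-.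
Qed.

(* R[i] is the field of complex numbers. The multiplicity, both geometric and
   algebraic, is at least #|W| - 1: other units (or other eigenvectors) may
   contribute to the same eigenvalue, so equality fails in general, e.g. when
   the hyperedges are two disjoint pairs of vertices. *)
Theorem theorem3p1 (R : realType) (H : hypergraph) (W : {set vertex H})
    (W_unit : W \in units H) (W_gt1 : (1 < #|W|)%N)
    (u v : vertex H) (uW : u \in W) (vW : v \in W) (neq_vu : v != u) :
  let A := adjacency1_mx R[i] H in
  let lambda := - edge_inner (incidence_col R[i] u) (incidence_col R[i] v) in
  [/\ eigenvalue A lambda,
      (#|W| - 1 <= \rank (eigenspace A lambda))%N
    & (#|W| - 1 <= mup lambda (char_poly A))%N].
Proof.
move=> A lambda.
have eq_star w : w \in W -> star w = star u by apply: unit_same_star.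
have lambdaE : lambda = - #|star u|%:R.
  by rewrite /lambda edge_innerE (eq_star v) // setIid.
have cardW : #|W :\ u| = (#|W| - 1)%N by rewrite (cardsD1 u W) uW addKn.
have geometric : (#|W| - 1 <= \rank (eigenspace A lambda))%N.
  have /eqP := vertex_diff_mx_free R[i] H u (W :\ u) (negbT (setD11 u W)).
  rewrite -cardW => {1}<-; apply: mxrankS; apply/eigenspaceP/row_matrixP => i.
  rewrite row_mul linearZ /= rowK lambdaE; apply: vertex_diff_mul_adjacency.
  by apply: eq_star; have /setD1P[] := enum_valP i.
split=> //.
  by rewrite /eigenvalue -mxrank_eq0 -lt0n (leq_trans _ geometric) ?subn_gt0.
rewrite (leq_trans geometric) // mup_geq ?monic_neq0 ?char_poly_monic //.
exact: exp_rank_eigenspace_dvd_char_poly.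
Qed.
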